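(* Let $F$ be a field of characteristic not $2$. The Peirce operator $\rho:F(\{x\})\to F[q]$ is an algebra homomorphism from $F(\{x\})$ to $(F[q],\star)$, where $\star$ is the commutative product on $F[q]$ given by $f\star g=q\,(f(\tfrac12)g+g(\tfrac12)f)$.
   Context: $F(\{x\})$ is the free commutative nonassociative $F$-algebra on one generator $x$ (without unit): its basis consists of the commutative nonassociative monomials (commutatively parenthesized words in $x$, equivalently abstract non-planar binary rooted trees with leaves labeled $x$, the product of monomials being grafting), and the product is extended bilinearly. The Peirce operator $\rho:F(\{x\})\to F[q]$, $P\mapsto\rho(P;q)$, is the unique $F$-linear map with $\rho(x;q)=1$ and $\rho(uv;q)=q(\rho(u;q)+\rho(v;q))$ for all monomials $u,v$. *)

(* Defs.v *)
From HB Require Import structures.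
From mathcomp Require Import all_boot all_order all_algebra.
From mathcomp Require Import generic_quotient finmap.
From mathcomp.multinomials Require Import monalg.

Set Implicit Arguments.
Unset Strict Implicit.
Unset Printing Implicit Defensive.

Import GRing.Theory.

Local Open Scope quotient_scope.
Local Open Scope ring_scope.

(* Planar binary rooted trees; forgetting the planar structure (quotient by   *)
(* swap_eq, below) gives the commutative nonassociative monomials in one      *)
(* generator.                                                                 *)
Inductive btree : Type := Leaf | Node of btree & btree.

Fixpoint btree_encode (t : btree) : GenTree.tree unit :=
  match t with
  | Leaf => GenTree.Leaf tt
  | Node l r => GenTree.Node 0 [:: btree_encode l; btree_encode r]
  end.

Fixpoint btree_decode (t : GenTree.tree unit) : btree :=
  match t with
  | GenTree.Node _ [:: l; r] => Node (btree_decode l) (btree_decode r)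
  | _ => Leaf
  end.

Lemma btree_encodeK : cancel btree_encode btree_decode.
Proof. by elim=> //= l -> r ->. Qed.

HB.instance Definition _ := Countable.copy btree (can_type btree_encodeK).

(* Equality of trees up to exchanging the two children of any nodes. *)
Fixpoint swap_eq (s t : btree) : bool :=
  match s, t with
  | Leaf, Leaf => true
  | Node a b, Node c d =>
      (swap_eq a c && swap_eq b d) || (swap_eq a d && swap_eq b c)
  | _, _ => false
  end.

Lemma swap_eq_refl : reflexive swap_eq.
Proof. by elim=> //= l -> r ->. Qed.

Lemma swap_eq_sym : symmetric swap_eq.
Proof.
elim=> [|a IHa b IHb] [|c d] //=.
by rewrite !IHa !IHb [swap_eq d a && _]andbC.
Qed.

Lemma swap_eq_trans : transitive swap_eq.
Proof.
move=> t s u; elim: t s u => [|a IHa b IHb] [|c d] [|e f] //=.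
case/orP=> /andP[h1 h2] /orP[] /andP[h3 h4]; apply/orP.
- by left; rewrite (IHa _ _ h1 h3) (IHb _ _ h2 h4).
- by right; rewrite (IHa _ _ h1 h3) (IHb _ _ h2 h4).
- by right; rewrite (IHb _ _ h1 h4) (IHa _ _ h2 h3).
- by left; rewrite (IHb _ _ h1 h4) (IHa _ _ h2 h3).
Qed.

Canonical swap_eq_equiv := EquivRel swap_eq swap_eq_refl swap_eq_sym swap_eq_trans.

Definition cmonomial := {eq_quot swap_eq}.

Definition cmgen : cmonomial := \pi_cmonomial Leaf.

Definition graft (u v : cmonomial) : cmonomial :=
  \pi_cmonomial (Node (repr u) (repr v)).

Lemma graft_pi (s t : btree) :
  graft (\pi_cmonomial s) (\pi_cmonomial t) = \pi_cmonomial (Node s t).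
Proof.
apply/eqmodP => /=; apply/orP; left; apply/andP.
by split; apply/eqmodP; rewrite reprK.
Qed.

Lemma graftC : commutative graft.
Proof.
move=> u v; apply/eqmodP => /=; apply/orP; right.
by rewrite !swap_eq_refl.
Qed.

Lemma cmonomial_ind (P : cmonomial -> Prop) :
  P cmgen -> (forall u v, P u -> P v -> P (graft u v)) -> forall u, P u.
Proof.
move=> Px Pm; elim/quotW; elim=> [//|s IHs t IHt].
by rewrite -graft_pi; apply: Pm.
Qed.

Section FreeAlgebra.

Variable F : fieldType.

(* The F-vector space with basis the monomials; the basis vector of the       *)
(* monomial u is << u >>.                                                     *)
Definition freecna : Type := {malg F[cmonomial]}.

Definition freecna_gen : freecna := << cmgen >>.

Definition freecna_mul (P Q : freecna) : freecna :=
  \sum_(u <- msupp P) \sum_(v <- msupp Q) (P@_u * Q@_v) *: << graft u v >>.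

Definition is_calg_mul (A : lmodType F) (mul : A -> A -> A) : Prop :=
  commutative mul /\ bilinear_for *:%R *:%R mul.

Definition is_alg_hom (A B : lmodType F)
    (mulA : A -> A -> A) (mulB : B -> B -> B) (f : A -> B) : Prop :=
  linear f /\ {morph f : x y / mulA x y >-> mulB x y}.

Definition linext (A : lmodType F) (phi : cmonomial -> A) (P : freecna) : A :=
  \sum_(u <- msupp P) P@_u *: phi u.

Lemma linextEw (A : lmodType F) (phi : cmonomial -> A) (P : freecna)
    (d : {fset cmonomial}) :
  {subset msupp P <= d} -> linext phi P = \sum_(u <- d) P@_u *: phi u.
Proof.
move=> sPd; rewrite /linext; apply: big_fset_incl; first exact/fsubsetP.
by move=> u _ nu; rewrite mcoeff_outdom // scale0r.
Qed.

Lemma linext_linear (A : lmodType F) (phi : cmonomial -> A) :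
  linear (linext phi).
Proof.
move=> c P Q; pose d := (msupp P `|` msupp Q `|` msupp (c *: P + Q))%fset.
have Ew R : {subset msupp R <= d} -> linext phi R = \sum_(u <- d) R@_u *: phi u.
  exact: linextEw.
rewrite (Ew P); last by move=> u hu; rewrite !in_fsetE hu.
rewrite (Ew Q); last by move=> u hu; rewrite !in_fsetE hu !orbT.
rewrite (Ew (c *: P + Q)); last by move=> u hu; rewrite !in_fsetE hu !orbT.
rewrite scaler_sumr -big_split; apply: eq_bigr => u _ /=.
by rewrite mcoeffD mcoeffZ scalerDl scalerA.
Qed.

Lemma linextU (A : lmodType F) (phi : cmonomial -> A) u :
  linext phi << u >> = phi u.
Proof.
rewrite /linext msuppU oner_eq0 big_seq_fset1 mcoeffUU scale1r //.
Qed.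

Lemma linext_unique (A : lmodType F) (phi : cmonomial -> A) (f : freecna -> A) :
  linear f -> (forall u, f << u >> = phi u) -> f =1 linext phi.
Proof.
move=> lf fU P.
pose fL : {linear freecna -> A} :=
  HB.pack f (GRing.isLinear.Build F freecna A *:%R f lf).
rewrite /linext -[f P]/(fL P) {1}[P]monalgE linear_sum; apply: eq_bigr => u _.
rewrite -(fU u) -[f _]/(fL _) -linearZ; congr (fL _).
by apply/malgP => k; rewrite mcoeffZ !mcoeffU mulrnAr mulr1.
Qed.

Lemma freecna_mulE P Q :
  freecna_mul P Q = linext (fun u => linext (fun v => << graft u v >>) Q) P.
Proof.
rewrite /freecna_mul /linext; apply: eq_bigr => u _.
by rewrite scaler_sumr; apply: eq_bigr => v _; rewrite scalerA.
Qed.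

Lemma freecna_mulC : commutative freecna_mul.
Proof.
move=> P Q; rewrite /freecna_mul exchange_big; apply: eq_bigr => v _.
by apply: eq_bigr => u _; rewrite mulrC graftC.
Qed.

Lemma freecna_mulU u v : freecna_mul << u >> << v >> = << graft u v >>.
Proof. by rewrite freecna_mulE !linextU. Qed.

Lemma freecna_calg : is_calg_mul freecna_mul.
Proof.
have lin P : linear (freecna_mul^~ P).
  by move=> c Q R; rewrite !freecna_mulE linext_linear.
split; first exact: freecna_mulC.
split=> P; first exact: lin.
by move=> c Q R /=; rewrite !(freecna_mulC P) lin.
Qed.

(* The indeterminate q is 'X. *)
Fixpoint peirce_tree (t : btree) : {poly F} :=
  match t with
  | Leaf => 1
  | Node l r => 'X * (peirce_tree l + peirce_tree r)
  end.

Lemma peirce_tree_swap s t : swap_eq s t -> peirce_tree s = peirce_tree t.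
Proof.
elim: s t => [|a IHa b IHb] [|c d] //=.
case/orP=> /andP[h1 h2]; first by rewrite (IHa _ h1) (IHb _ h2).
by rewrite (IHa _ h1) (IHb _ h2) addrC.
Qed.

Definition peirce : freecna -> {poly F} := linext (fun u => peirce_tree (repr u)).

Lemma peirce_linear : linear peirce.
Proof. exact: linext_linear. Qed.

HB.instance Definition _ :=
  GRing.isLinear.Build F freecna {poly F} *:%R peirce peirce_linear.

Lemma peirce_gen : peirce freecna_gen = 1.
Proof.
rewrite /peirce linextU -[1]/(peirce_tree Leaf); apply: peirce_tree_swap.
by apply/eqmodP; rewrite reprK.
Qed.

Lemma peirce_graft u v :
  peirce << graft u v >> = 'X * (peirce << u >> + peirce << v >>).
Proof.
rewrite /peirce !linextU -[RHS]/(peirce_tree (Node (repr u) (repr v))).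
by apply: peirce_tree_swap; apply/eqmodP; rewrite reprK.
Qed.

Lemma peirce_unique (f : freecna -> {poly F}) :
  linear f -> f freecna_gen = 1 ->
  (forall u v, f (freecna_mul << u >> << v >>) = 'X * (f << u >> + f << v >>)) ->
  f =1 peirce.
Proof.
move=> lf f1 fM; apply: linext_unique => // u.
rewrite -[RHS](linextU (fun u => peirce_tree (repr u))) -/peirce.
elim/cmonomial_ind: u => [|u v IHu IHv]; first by rewrite f1 peirce_gen.
by rewrite -freecna_mulU fM freecna_mulU peirce_graft IHu IHv.
Qed.

(* f(1/2) is only the intended value when 2 != 0 in F. *)
Definition star (f g : {poly F}) : {poly F} :=
  'X * (f.[2^-1] *: g + g.[2^-1] *: f).

End FreeAlgebra.

(* Main.v *)
Require Import Defs.
From mathcomp Require Import all_boot all_order all_algebra.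
From mathcomp.multinomials Require Import monalg.
From mathcomp Require Import ring.
Import GRing.Theory.
Local Open Scope ring_scope.

(** Every monomial has Peirce polynomial with value 1 at 1/2: this holds for
    the generator, and the recursion [q (f + g)] gives 1/2 (1 + 1) = 1 at
    q = 1/2. Hence on monomials the weights [f(1/2)] and [g(1/2)] in the product
    [star] are both 1, and [star] reduces to the very recursion
    [q (f + g)] that defines the Peirce operator on a product of monomials
    ([peirce_tree_half], [star_half1]). Both sides of the morphism identity
    are bilinear, so agreement on the basis of monomials is enough
    ([linear_monomial_ext], used in each variable in turn). Characteristic
    different from 2 enters only in 1/2 (1 + 1) = 1. *)

Lemma linear_monomial_ext (F : fieldType) (A : lmodType F)
    (f g : freecna F -> A) :
  linear f -> linear g -> (forall u, f << u >> = g << u >>) -> f =1 g.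
Proof.
move=> lf lg fg P.
by rewrite (linext_unique lf fg) -(linext_unique lg (fun u => erefl)).
Qed.

Lemma starC (F : fieldType) : commutative (@star F).
Proof. by move=> f g; rewrite /star addrC. Qed.

Lemma star_linearl (F : fieldType) (h : {poly F}) : linear (@star F ^~ h).
Proof.
move=> c f g; rewrite /star !hornerE -!mul_polyC !polyCD !polyCM.
ring.
Qed.

Lemma star_calg (F : fieldType) : is_calg_mul (@star F).
Proof.
split; first exact: starC.
split=> h; first exact: star_linearl.
by move=> c f g /=; rewrite !(starC _ h) star_linearl.
Qed.

(** The condition [f(1/2) = 1] is stable under [f, g |-> q (f + g)], because at
    q = 1/2 the result takes the average of the two values. *)
Lemma horner_half_mulX_add (F : fieldType) (charF : 2%N \notin [pchar F])
    (f g : {poly F}) :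
  f.[2^-1] = 1 -> g.[2^-1] = 1 -> ('X * (f + g)).[2^-1] = 1.
Proof.
have two_neq0 : (2 : F) != 0 by move: charF; rewrite inE.
by move=> f1 g1; rewrite !hornerE f1 g1 mulVf.
Qed.

Lemma star_half1 (F : fieldType) (f g : {poly F}) :
  f.[2^-1] = 1 -> g.[2^-1] = 1 -> star f g = 'X * (f + g).
Proof. by move=> f1 g1; rewrite /star f1 g1 !scale1r [in RHS]addrC. Qed.

Lemma peirce_tree_half (F : fieldType) (charF : 2%N \notin [pchar F]) t :
  (peirce_tree F t).[2^-1] = 1.
Proof.
elim: t => [|l IHl r IHr]; first exact: hornerC.
exact: horner_half_mulX_add.
Qed.

Lemma peirce_monomial_half (F : fieldType) (charF : 2%N \notin [pchar F]) u :
  (@peirce F << u >>).[2^-1] = 1.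
Proof. rewrite /peirce linextU; exact: peirce_tree_half. Qed.

Lemma peirce_mul_monomials (F : fieldType) (charF : 2%N \notin [pchar F]) u v :
  @peirce F (freecna_mul << u >> << v >>) =
  star (peirce << u >>) (peirce << v >>).
Proof.
rewrite freecna_mulU peirce_graft; symmetry.
apply: star_half1; exact: peirce_monomial_half.
Qed.

Lemma peirce_mul (F : fieldType) (charF : 2%N \notin [pchar F]) :
  {morph @peirce F : P Q / freecna_mul P Q >-> star P Q}.
Proof.
have [_ [mul_linl mul_linr]] := freecna_calg F.
have [_ [star_linl star_linr]] := star_calg F.
move=> P Q; move: P; apply: linear_monomial_ext => [c P P'|c P P'|u].
- by rewrite mul_linl linearP.
- by rewrite linearP star_linl.
move: Q; apply: linear_monomial_ext => [c Q Q'|c Q Q'|v].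
- by rewrite mul_linr linearP.
- by rewrite linearP star_linr.
exact: peirce_mul_monomials.
Qed.

Theorem theorem2p13 (F : fieldType) (charF : 2%N \notin [pchar F]) :
  is_calg_mul (@star F) /\
  is_alg_hom (@freecna_mul F) (@star F) (@peirce F).
Proof.
split; first exact: star_calg.
split; [exact: peirce_linear | exact: peirce_mul].
Qed.
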